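(* Let $\dot x=f(t,x)$ be a positive dynamical system on $\mathbb{R}^n$ with equilibrium point $0_n$, let $\|\cdot\|$ be a norm on $\mathbb{R}^n$ with associated weak pairing $\llbracket\cdot,\cdot\rrbracket$ satisfying Deimling's inequality and the curve norm derivative formula, and let $b\in\mathbb{R}$. Consider the conditions: (A1) $\llbracket f(t,x),x\rrbracket\le b\|x\|^2$ for every $(t,x)\in\mathbb{R}_{\ge0}\times\mathbb{R}^n_{\ge0}$; (A2) $\|\phi(t,t_0,x_0)\|\le e^{b(t-s)}\|\phi(s,t_0,x_0)\|$ for every $t_0\le s\le t$ and every $x_0\in\mathbb{R}^n_{\ge0}$; (A3) $\mu^{+}(B(t,x))\le b$ for every $x\ge0_n$ and every $t\in\mathbb{R}_{\ge0}$, where $B(t,x)\in\mathbb{R}^{n\times n}$ is such that $f(t,x)=B(t,x)x$. Then: (i) (A1) and (A2) are equivalent; (ii) (A3) implies (A1) and (A2).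
   Context: Inequalities between vectors are entrywise; $0_n$ is the zero vector. The system is positive if $\mathbb{R}^n_{\ge0}$ is forward invariant. $\phi(t,t_0,x_0)$ denotes the flow of $f$ at time $t$ starting at time $t_0\ge0$ from $x_0$ ($f$ is assumed regular enough for the flow to be defined). The conic matrix measure of $A\in\mathbb{R}^{n\times n}$ with respect to $\|\cdot\|$ is $\displaystyle\mu^{+}(A)=\lim_{h\to0^{+}}\ \sup_{x\ge 0_n,\ x\neq 0_n}\frac{\|(I_n+hA)x\|/\|x\|-1}{h}$. A weak pairing (WP) on $\mathbb{R}^n$ is a map $\llbracket\cdot,\cdot\rrbracket:\mathbb{R}^n\times\mathbb{R}^n\to\mathbb{R}$ such that: (1) $\llbracket x_1+x_2,y\rrbracket\le\llbracket x_1,y\rrbracket+\llbracket x_2,y\rrbracket$ for all $x_1,x_2,y$, and it is continuous in its first argument; (2) $\llbracket\alpha x,y\rrbracket=\llbracket x,\alpha y\rrbracket=\alpha\llbracket x,y\rrbracket$ and $\llbracket -x,-y\rrbracket=\llbracket x,y\rrbracket$ for all $x,y$ and $\alpha\ge0$; (3) $\llbracket x,x\rrbracket>0$ for all $x\ne0_n$; (4) $|\llbracket x,y\rrbracket|\le\llbracket x,x\rrbracket^{1/2}\llbracket y,y\rrbracket^{1/2}$ for all $x,y$. It is associated with the norm $\|\cdot\|$ if $\|x\|^2=\llbracket x,x\rrbracket$ for all $x$. It satisfies Deimling's inequality if $\llbracket x,y\rrbracket\le\|y\|\lim_{h\to0^{+}}\frac{\|y+hx\|-\|y\|}{h}$ for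 all $x,y\in\mathbb{R}^n$. It satisfies the curve norm derivative formula if, for every differentiable $x:(a,b)\to\mathbb{R}^n$ and almost every $t\in(a,b)$, $\|x(t)\|D^{+}\|x(t)\|=\llbracket\dot x(t),x(t)\rrbracket$, where $D^{+}$ is the upper Dini derivative. *)

(* Defs.v *)
From HB Require Import structures.
From mathcomp Require Import all_boot all_order all_algebra.
From mathcomp Require Import all_classical all_reals all_analysis.
Set Implicit Arguments.
Unset Strict Implicit.
Unset Printing Implicit Defensive.
Import Order.TTheory GRing.Theory Num.Theory.
Import numFieldNormedType.Exports.

Local Open Scope classical_set_scope.
Local Open Scope ring_scope.

Definition orthant {R : realType} {n : nat} : set 'cV[R]_n :=
  [set x | forall i, 0 <= x i ord0].

(** * Time-varying vector fields and their flows *)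

(* A vector field is total in the time variable, but is only ever used at
   times [t >= 0].  Solutions are classical; at the initial time only the
   derivative from the right is meaningful. *)
Definition is_solution {R : realType} {n : nat}
    (f : R -> 'cV[R]_n -> 'cV[R]_n) (t0 : R) (x : R -> 'cV[R]_n) : Prop :=
  h^-1 *: (x (t0 + h) - x t0) @[h --> 0^'+] --> f t0 (x t0) /\
  (forall t, t0 < t -> is_derive t 1 x (f t (x t))).

(* [phi t t0 x0] is the state at time [t] of the trajectory started at time
   [t0] from [x0]; existence for all [t >= t0] and uniqueness are required for
   the initial states in [D]. *)
Definition is_flow_on {R : realType} {n : nat} (D : set 'cV[R]_n)
    (f : R -> 'cV[R]_n -> 'cV[R]_n) (phi : R -> R -> 'cV[R]_n -> 'cV[R]_n)
    : Prop :=
  forall (t0 : R) (x0 : 'cV[R]_n), 0 <= t0 -> D x0 ->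
    [/\ phi t0 t0 x0 = x0,
        is_solution f t0 (fun t => phi t t0 x0)
      & forall y, is_solution f t0 y -> y t0 = x0 ->
          forall t, t0 <= t -> y t = phi t t0 x0].

Definition forward_invariant {R : realType} {n : nat} (D : set 'cV[R]_n)
    (phi : R -> R -> 'cV[R]_n -> 'cV[R]_n) : Prop :=
  forall (t0 t : R) (x0 : 'cV[R]_n), 0 <= t0 -> t0 <= t -> D x0 -> D (phi t t0 x0).

Definition equilibrium {R : realType} {n : nat}
    (f : R -> 'cV[R]_n -> 'cV[R]_n) (xe : 'cV[R]_n) : Prop :=
  forall t : R, 0 <= t -> f t xe = 0.

(** * Norms, weak pairings and the conic matrix measure *)

(* An arbitrary norm on R^n; limits and derivatives of vector-valued maps are
   taken in the canonical topology of ['cV[R]_n], which every norm induces. *)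
Definition is_norm {R : realType} {n : nat} (nrm : 'cV[R]_n -> R) : Prop :=
  [/\ forall x y : 'cV[R]_n, nrm (x + y) <= nrm x + nrm y,
      forall (a : R) (x : 'cV[R]_n), nrm (a *: x) = `|a| * nrm x
    & forall x, nrm x = 0 -> x = 0].

Definition weak_pairing {R : realType} {n : nat}
    (wp : 'cV[R]_n -> 'cV[R]_n -> R) : Prop :=
  [/\ (forall x1 x2 y : 'cV[R]_n, wp (x1 + x2) y <= wp x1 y + wp x2 y) /\
      (forall y, continuous (fun x => wp x y)),
      (forall (a : R) (x y : 'cV[R]_n), 0 <= a ->
         wp (a *: x) y = a * wp x y /\ wp x (a *: y) = a * wp x y) /\
      (forall x y : 'cV[R]_n, wp (- x) (- y) = wp x y),
      forall x : 'cV[R]_n, x != 0 -> 0 < wp x x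
    & forall x y, `|wp x y| <= Num.sqrt (wp x x) * Num.sqrt (wp y y)].

Definition associated {R : realType} {n : nat}
    (wp : 'cV[R]_n -> 'cV[R]_n -> R) (nrm : 'cV[R]_n -> R) : Prop :=
  forall x, nrm x ^+ 2 = wp x x.

(* The limit exists for every norm: the quotient is monotone in [h] and bounded
   below. *)
Definition deimling {R : realType} {n : nat}
    (wp : 'cV[R]_n -> 'cV[R]_n -> R) (nrm : 'cV[R]_n -> R) : Prop :=
  forall x y,
    wp x y <= nrm y * lim ((nrm (y + h *: x) - nrm y) / h @[h --> 0^'+]).

Definition upper_dini {R : realType} (g : R -> R) (t : R) : \bar R :=
  limf_esup (fun h : R => ((g (t + h) - g t) / h)%:E) 0^'+.

(* Differentiability at the points of an open interval is local, so the curve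
   is given as a total function of which only the values on the interval
   matter. *)
Definition curve_norm_derivative {R : realType} {n : nat}
    (wp : 'cV[R]_n -> 'cV[R]_n -> R) (nrm : 'cV[R]_n -> R) : Prop :=
  forall (a b : R) (x : R -> 'cV[R]_n),
    (forall t, a < t < b -> derivable x t 1) ->
    {ae lebesgue_measure, forall t : R, a < t < b ->
       ((nrm (x t))%:E * upper_dini (fun s => nrm (x s)) t
        = (wp ('D_1 x t) (x t))%:E)%E}.

(* For [n > 0] the supremum is that of a nonempty bounded set and the limit
   exists, so [sup] and [lim] do not take their default values. *)
Definition conic_measure {R : realType} {n : nat} (nrm : 'cV[R]_n -> R)
    (A : 'M[R]_n) : R :=
  lim (sup [set (nrm ((1%:M + h *: A) *m x) / nrm x - 1) / h
             | x in [set x : 'cV[R]_n | orthant x /\ x != 0]]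
       @[h --> 0^'+]).

(** * The three conditions *)

Definition condA1 {R : realType} {n : nat} (f : R -> 'cV[R]_n -> 'cV[R]_n)
    (nrm : 'cV[R]_n -> R) (wp : 'cV[R]_n -> 'cV[R]_n -> R) (b : R) : Prop :=
  forall (t : R) (x : 'cV[R]_n), 0 <= t -> orthant x -> wp (f t x) x <= b * nrm x ^+ 2.

Definition condA2 {R : realType} {n : nat}
    (phi : R -> R -> 'cV[R]_n -> 'cV[R]_n) (nrm : 'cV[R]_n -> R) (b : R)
    : Prop :=
  forall (t0 s t : R) (x0 : 'cV[R]_n),
    0 <= t0 -> t0 <= s -> s <= t -> orthant x0 ->
    nrm (phi t t0 x0) <= expR (b * (t - s)) * nrm (phi s t0 x0).

Definition condA3 {R : realType} {n : nat} (f : R -> 'cV[R]_n -> 'cV[R]_n)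
    (nrm : 'cV[R]_n -> R) (B : R -> 'cV[R]_n -> 'M[R]_n) (b : R) : Prop :=
  forall (t : R) (x : 'cV[R]_n), 0 <= t -> orthant x ->
    f t x = B t x *m x /\ conic_measure nrm (B t x) <= b.

(* Main.v *)
Require Import Defs.
From mathcomp Require Import all_boot all_order all_algebra.
From mathcomp Require Import all_classical all_reals all_analysis.
From mathcomp Require Import measurable_realfun ring lra.
Set Implicit Arguments.
Unset Strict Implicit.
Unset Printing Implicit Defensive.
Import Order.TTheory GRing.Theory Num.Theory.
Import numFieldNormedType.Exports.
Local Open Scope classical_set_scope.
Local Open Scope ring_scope.

(* Deimling's inequality bounds the weak pairing of [v] and [x] by [nrm x] times
   the right derivative of the norm at [x] in the direction [v].  With
   [v = f t x], (A2) bounds this derivative along the trajectory started from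
   [x] at time [t], and (A3) bounds it by [nrm x] times the conic measure of
   [B t x]; both give (A1).

   For (A1) => (A2), put [y t = e^(- b t) x t] and [u t = nrm (y t)].  The curve
   norm derivative formula yields [D^+ u <= 0] almost everywhere.  As [f] has no
   regularity, [u] need not be absolutely continuous; but [y] is differentiable,
   so [D^+ u < +oo] everywhere, and comparing [u] with a small monotone function
   of infinite slope on the exceptional null set shows that [u] is nonincreasing.
   Where [u] vanishes the formula is void, but there the trajectory has reached
   the equilibrium and stays there by uniqueness. *)

(** * Norms on column vectors, directional difference quotients and the conic measure *)

Definition dirquot {R : realType} {n : nat} (nrm : 'cV[R]_n -> R)
  (y v : 'cV[R]_n) (h : R) : R := (nrm (y + h *: v) - nrm y) / h.

Lemma le_dist_continuous {R : realType} {V : normedModType R} (g : V -> R) C :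
  0 < C -> (forall x y, `|g x - g y| <= C * `|x - y|) -> continuous g.
Proof.
move=> C0 gC x; apply/(@cvgrPdist_le _ _ _ _ (nbhs_filter x)) => e e0.
near=> y; rewrite (le_trans (gC _ _))// -ler_pdivlMl//.
near: y; apply: (@cvgr_dist_le _ _ _ _ (nbhs_filter x) id x) => //.
by rewrite mulr_gt0 ?invr_gt0.
Unshelve. all: by end_near. Qed.

Section norm_theory.
Context {R : realType} {n : nat} (nrm : 'cV[R]_n -> R) (Hn : is_norm nrm).
Implicit Types (x y v : 'cV[R]_n) (h k : R).

Lemma is_norm_triangle x y : nrm (x + y) <= nrm x + nrm y.
Proof. by case: Hn. Qed.

Lemma is_normZ k x : nrm (k *: x) = `|k| * nrm x.
Proof. by case: Hn. Qed.

Lemma is_norm0 : nrm 0 = 0.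
Proof. by rewrite -(scale0r 0) is_normZ normr0 mul0r. Qed.

Lemma is_normN x : nrm (- x) = nrm x.
Proof. by rewrite -scaleN1r is_normZ normrN1 mul1r. Qed.

Lemma is_norm_ge0 x : 0 <= nrm x.
Proof.
have := is_norm_triangle x (- x); rewrite subrr is_norm0 is_normN.
by rewrite -mulr2n pmulrn_lge0.
Qed.

Lemma is_norm_gt0 x : x != 0 -> 0 < nrm x.
Proof.
move=> x0; rewrite lt_neqAle is_norm_ge0 andbT eq_sym; apply: contra x0.
by case: Hn => _ _ n0 /eqP/n0/eqP.
Qed.

Lemma is_normB_le x y : nrm x - nrm y <= nrm (x - y).
Proof. by rewrite lerBlDr -{1}(subrK y x) is_norm_triangle. Qed.

Lemma is_norm_dist x y : `|nrm x - nrm y| <= nrm (x - y).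
Proof.
rewrite ler_norml is_normB_le andbT lerNl opprB.
by rewrite -[leRHS]is_normN opprB is_normB_le.
Qed.

Lemma is_norm_sum (I : Type) (r : seq I) (F : I -> 'cV[R]_n) :
  nrm (\sum_(i <- r) F i) <= \sum_(i <- r) nrm (F i).
Proof.
elim/big_ind2 : _ => // [|x a y c xa yc]; first by rewrite is_norm0.
by rewrite (le_trans (is_norm_triangle _ _))// lerD.
Qed.

Lemma mx_entry_le_norm m p (A : 'M[R]_(m, p)) i j : `|A i j| <= `|A|.
Proof.
rewrite [leRHS]/Num.norm/= mx_normrE.
by apply/bigmax_geP; right; exists (i, j).
Qed.

Lemma is_norm_le_mx_norm : exists2 C, 0 < C & forall x, nrm x <= C * `|x|.
Proof.
(* The added 1 keeps the constant positive in dimension 0, where the sum is empty. *)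
pose C := \sum_i nrm (delta_mx i ord0); exists (C + 1).
  by rewrite ltr_pwDr// sumr_ge0// => i _; exact: is_norm_ge0.
move=> x; rewrite mulrDl mul1r ler_wpDr// {1}(matrix_sum_delta x).
rewrite mulr_suml (le_trans (is_norm_sum _ _))// ler_sum// => i _.
rewrite big_ord1 is_normZ mulrC ler_wpM2l// ?is_norm_ge0//.
exact: mx_entry_le_norm.
Qed.

Lemma is_norm_continuous : continuous nrm.
Proof.
have [C C0 nC] := is_norm_le_mx_norm.
apply: (le_dist_continuous C0) => x y.
by rewrite (le_trans (is_norm_dist _ _)).
Qed.

Lemma mx_norm_trmx m p (A : 'M[R]_(m, p)) : `|A^T| = `|A|.
Proof.
suff le (q r : nat) (M : 'M[R]_(q, r)) : `|M^T| <= `|M|.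
  by apply/eqP; rewrite eq_le le -{1}(trmxK A) le.
rewrite [leLHS]/Num.norm/= mx_normrE; apply/bigmax_leP; split => // -[i j] _ /=.
by rewrite mxE mx_entry_le_norm.
Qed.

(** On the compact unit sphere of the matrix norm, [nrm] attains a minimum; it is positive, and
    homogeneity extends the bound to all vectors. The sphere is taken among row vectors, the setting
    of [EVT_min_rV]. *)
Lemma mx_norm_le_is_norm : exists2 C, 0 < C & forall x, `|x| <= C * nrm x.
Proof.
have [C C0 nC] := is_norm_le_mx_norm.
pose S := [set u : 'rV[R]_n | `|u| = 1].
have cf : continuous (fun u : 'rV[R]_n => nrm u^T).
  apply: (le_dist_continuous C0) => u w.
  rewrite (le_trans (is_norm_dist _ _))//.
  by rewrite -linearB/= (le_trans (nC _))// mx_norm_trmx.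
have cS : compact S.
  apply: bounded_closed_compact.
    by exists 1; split => // M M1 u /= ->; exact: ltW.
  have -> : S = (fun u : 'rV[R]_n => `|u|) @^-1` [set 1] by [].
  apply: closed_comp => [u _|]; first exact: norm_continuous.
  exact: closed_eq.
have S1 x : x != 0 -> S (`|x|^-1 *: x)^T.
  move=> x0.
  by rewrite /S/= mx_norm_trmx normrZ normfV normr_id mulVf ?normr_eq0.
(* If the sphere is empty, every vector is zero and any constant works. *)
have [[u Su]|/set0P/negP/negPn/eqP S0] := pselect (S !=set0); last first.
  exists 1 => // x; have [->|/S1] := eqVneq x 0; last by rewrite S0.
  by rewrite normr0 is_norm0 mulr0.
have [w] := EVT_min_rV (ex_intro _ u Su) cS (continuous_subspaceT cf).
rewrite inE => Sw wmin.
have w0 : 0 < nrm w^T.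
  apply: is_norm_gt0; apply/eqP => /(congr1 Num.norm).
  rewrite mx_norm_trmx normr0 Sw; exact/eqP/oner_neq0.
exists (nrm w^T)^-1; first by rewrite invr_gt0.
move=> x; have [->|x0] := eqVneq x 0; first by rewrite normr0 is_norm0 mulr0.
have := wmin _ (mem_set (S1 _ x0)).
rewrite trmxK is_normZ normfV normr_id ler_pdivlMl ?normr_gt0// => le.
by rewrite ler_pdivlMl// mulrC.
Qed.

Lemma is_norm_mulmx_bounded (A : 'M[R]_n) :
  exists2 C, 0 < C & forall x, nrm (A *m x) <= C * nrm x.
Proof.
have [C C0 nC] := is_norm_le_mx_norm; have [D D0 nD] := mx_norm_le_is_norm.
pose K := \sum_(i : 'I_n) nrm (col i A).
have K0 : 0 <= K by rewrite sumr_ge0// => i _; exact: is_norm_ge0.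
exists (K * D + 1); first by rewrite ltr_pwDr// mulr_ge0// ltW.
move=> x; rewrite mulrDl mul1r ler_wpDr ?is_norm_ge0//.
have -> : A *m x = \sum_i x i ord0 *: col i A.
  apply/matrixP => i j; rewrite !mxE summxE; apply: eq_bigr => k _.
  by rewrite !mxE mulrC (ord1 j).
rewrite -mulrA mulr_suml (le_trans (is_norm_sum _ _))// ler_sum// => i _.
rewrite is_normZ mulrC ler_wpM2l ?is_norm_ge0//.
exact: le_trans (mx_entry_le_norm _ _ _) (nD _).
Qed.

(** Convexity of the norm: [y + h *: v] is the convex combination of [y] and [y + k *: v] with
    weights [1 - h / k] and [h / k]. *)
Lemma dirquot_le y v h k : 0 < h -> h <= k ->
  dirquot nrm y v h <= dirquot nrm y v k.
Proof.
move=> h0 hk; have k0 : 0 < k := lt_le_trans h0 hk.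
have -> : dirquot nrm y v k = (h / k * nrm (y + k *: v) - h / k * nrm y) / h.
  by rewrite /dirquot; field; rewrite !gt_eqF.
rewrite ler_pM2r ?invr_gt0//.
have -> : y + h *: v = (1 - h / k) *: y + (h / k) *: (y + k *: v).
  by rewrite scalerDr scalerA divfK ?gt_eqF// addrA -scalerDl subrK scale1r.
have hk1 : 0 <= h / k by rewrite divr_ge0// ltW.
rewrite lerBlDr (le_trans (is_norm_triangle _ _))// !is_normZ.
rewrite (ger0_norm hk1) ger0_norm; last by rewrite subr_ge0 ler_pdivrMr// mul1r.
by rewrite mulrBl mul1r addrAC -addrA addrC.
Qed.

Lemma dirquot_bounded y v h : 0 < h -> `|dirquot nrm y v h| <= nrm v.
Proof.
move=> h0; rewrite normrM normfV (gtr0_norm h0) ler_pdivrMr//.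
rewrite (le_trans (is_norm_dist _ _))// addrC addKr is_normZ gtr0_norm//.
by rewrite mulrC.
Qed.

Lemma dirquot_cvg y v : cvg (dirquot nrm y v h @[h --> 0^'+]).
Proof.
apply: nondecreasing_at_right_is_cvgr; near=> r.
  move=> h k; rewrite !in_itv/= => /andP[h0 _] _ hk.
  exact: dirquot_le.
exists (- nrm v) => z [h]; rewrite /= in_itv/= => /andP[h0 _] <-.
by have := dirquot_bounded y v h0; rewrite ler_norml => /andP[].
Unshelve. all: by end_near. Qed.

(** For [h <= 1] the factor in [y - h *: y = (1 - h) *: y] is nonnegative, so the quotient is
    exactly [- nrm y]. *)
Lemma lim_dirquotN y : lim (dirquot nrm y (- y) h @[h --> 0^'+]) <= - nrm y.
Proof.
apply: limr_le; first exact: dirquot_cvg.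
near=> h; have h0 : 0 < h by [].
rewrite /dirquot scalerN -scaleNr -{1}(scale1r y) -scalerDl is_normZ ger0_norm.
  by rewrite ler_pdivrMr// mulrDl mulNr mul1r addrAC subrr add0r mulNr mulrC.
rewrite subr_ge0; near: h; exact: nbhs_right_le.
Unshelve. all: by end_near. Qed.

Let conic_quotE (A : 'M[R]_n) h x : x != 0 ->
  (nrm ((1%:M + h *: A) *m x) / nrm x - 1) / h =
  dirquot nrm x (A *m x) h / nrm x.
Proof.
move=> /is_norm_gt0 x0; rewrite mulmxDl mul1mx -scalemxAl /dirquot.
by rewrite [RHS]mulrAC [in RHS]mulrBl divff ?gt_eqF.
Qed.

Let conic_quot_bounded (A : 'M[R]_n) : exists C, forall h x, 0 < h -> x != 0 ->
  `|dirquot nrm x (A *m x) h / nrm x| <= C.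
Proof.
have [C C0 AC] := is_norm_mulmx_bounded A; exists C => h x h0 x0.
have nx := is_norm_gt0 x0; rewrite normrM normfV (gtr0_norm nx).
by rewrite ler_pdivrMr// (le_trans (dirquot_bounded _ _ h0)).
Qed.

(** At each [h] the quotient at [x], divided by [nrm x], is one of the values under the supremum,
    and the inequality passes to the limit. As [sup] and [lim] have default values, boundedness and
    convergence come first. *)
Lemma lim_dirquot_conic (A : 'M[R]_n) x : orthant x -> x != 0 ->
  lim (dirquot nrm x (A *m x) h @[h --> 0^'+]) <= nrm x * conic_measure nrm A.
Proof.
move=> ox x0; have nx := is_norm_gt0 x0.
pose conic_set h := [set (nrm ((1%:M + h *: A) *m y) / nrm y - 1) / h
  | y in [set y : 'cV[R]_n | orthant y /\ y != 0]].
have [C AC] := conic_quot_bounded A.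
have ubC h : 0 < h -> has_ubound (conic_set h).
  move=> h0; exists C => _ [y [_ y0] <-]; rewrite conic_quotE//.
  exact: le_trans (ler_norm _) (AC _ _ h0 y0).
have le_sup h y : 0 < h -> orthant y -> y != 0 ->
    dirquot nrm y (A *m y) h / nrm y <= sup (conic_set h).
  move=> h0 oy y0; apply: ub_le_sup; first exact: ubC.
  by exists y => //; rewrite conic_quotE.
(* The supremum inherits monotonicity in [h] from each quotient, and the quotient at [x] bounds it
   below by [- C]. *)
have cS : cvg (sup (conic_set h) @[h --> 0^'+]).
  apply: nondecreasing_at_right_is_cvgr; near=> r.
    move=> h k; rewrite !in_itv/= => /andP[h0 _] /andP[k0 _] hk.
    apply: ge_sup.
      exists (dirquot nrm x (A *m x) h / nrm x); exists x => //.
      by rewrite conic_quotE.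
    move=> _ [y [oy y0] <-]; rewrite conic_quotE//.
    apply: le_trans (le_sup k y k0 oy y0).
    by rewrite ler_pM2r ?invr_gt0 ?is_norm_gt0// dirquot_le.
  exists (- C) => z [h]; rewrite /= in_itv/= => /andP[h0 _] <-.
  apply: le_trans (le_sup h x h0 ox x0).
  by have := AC h x h0 x0; rewrite ler_norml => /andP[].
have -> : nrm x * conic_measure nrm A =
    lim (nrm x * sup (conic_set h) @[h --> 0^'+]).
  by apply/esym/cvg_lim => //; apply: cvgMr.
apply: ler_lim; [exact: dirquot_cvg | exact: is_cvgMr |].
near=> h; have h0 : 0 < h by [].
by rewrite -ler_pdivrMl// mulrC le_sup.
Unshelve. all: by end_near. Qed.

End norm_theory.

(** * Monotonicity from Dini derivatives outside a null set *)

Section dini.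
Context {R : realType}.
Implicit Types (N : set R) (G v : R -> R) (t h M : R).
Local Notation mu := (@lebesgue_measure R).

Lemma near_right0_itv (P : set R) :
  (\forall h \near 0^'+, P h) -> exists2 r, 0 < r & forall h, 0 < h < r -> P h.
Proof.
move=> [r /= r0 rP]; exists r => // h /andP[h0 hr]; apply: rP => //=.
by rewrite sub0r normrN gtr0_norm.
Qed.

(* [G t = \sum_k mu (U_k `&` `]-oo, t])] for open [U_k] containing [N] with
   [\sum_k mu U_k <= e]: at a point of [N] the right derivative of each term
   is at least 1. *)
Lemma negligible_infinite_slope N (e : R) : 0 < e -> mu.-negligible N ->
  exists G, [/\ {homo G : s t / s <= t}, forall t, 0 <= G t <= e
    & forall t M, N t -> \forall h \near 0^'+, G t + M * h <= G (t + h)].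
Proof.
move=> e0 [A [mA A0 NA]].
have /choice[U HU] : forall k : nat, exists U : set R,
    [/\ open U, A `<=` U & (mu U <= (e / (2 ^ k.+1)%:R)%:E)%E].
  move=> k; have ek : 0 < e / (2 ^ k.+1)%:R by rewrite divr_gt0.
  have [|U [oU AU UA]] := lebesgue_regularity_outer mA _ ek.
    by rewrite [ltLHS]A0.
  have mU := open_measurable oU.
  exists U; split => //; rewrite -(setDUK AU).
  rewrite (le_trans (measureU2 _ mA _))//; first exact: measurableD.
  by rewrite [X in (X + _ <= _)%E]A0 add0e ltW.
have mU k : measurable (U k) by have [/open_measurable] := HU k.
pose g (s : R) k := mu (U k `&` `]-oo, s]).
have mUt k (s : R) : measurable (U k `&` `]-oo, s]) by exact: measurableI.
have g0 t k : (0 <= g t k)%E by exact: measure_ge0.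
have gle t k : (g t k <= (e / (2 ^ k.+1)%:R)%:E)%E.
  have [_ _] := HU k; apply: le_trans; apply: le_measure; rewrite ?inE//.
  - exact: mUt.
  - exact: mU.
have gm (s t : R) k : s <= t -> (g s k <= g t k)%E.
  move=> st; apply: le_measure; rewrite ?inE; [exact: mUt|exact: mUt|].
  by apply: setIS => x /=; rewrite !in_itv/= => /le_trans; exact.
have sle : forall t, (\sum_(0 <= k <oo) g t k <= e%:E)%E.
  move=> t.
  by rewrite (le_trans (lee_nneseries _ _) (epsilon_trick0 xpredT (ltW e0))).
have s0 : forall t, (0 <= \sum_(0 <= k <oo) g t k)%E.
  by move=> t; exact: nneseries_ge0.
have sfin : forall t, (\sum_(0 <= k <oo) g t k)%E \is a fin_num.
  by move=> t; rewrite ge0_fin_numE// (le_lt_trans (sle t))// ltry.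
exists (fun t => fine (\sum_(0 <= k <oo) g t k)%E); split.
- move=> s t st; rewrite fine_le//.
  by apply: lee_nneseries => // k _; exact: gm.
- by move=> t; rewrite fine_ge0//= -lee_fin fineK.
(* The first [m >= M] open sets already give slope [M]: each contains an interval to the right of
   [t], hence contributes at least [h] for small [h], and finitely many such conditions hold
   together. The other terms are nondecreasing. *)
move=> t M Nt; pose m := Num.bound `|M|.
have Mm : M <= m%:R.
  by rewrite (le_trans (ler_norm _))// ltW// archi_boundP.
have Ut (k : 'I_m) : \forall h \near 0^'+, `]t, t + h] `<=` U k.
  have [oU AU _] := HU k; have /oU[r /= r0 rU] := AU _ (NA _ Nt).
  near=> h => s /=; rewrite in_itv/= => /andP[ts sth]; apply: rU => /=.
  rewrite ltr_distlC; apply/andP; split.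
    by rewrite (lt_trans _ ts)// ltrBlDr ltrDl.
  rewrite (le_lt_trans sth)// ltrD2l; near: h; exact: nbhs_right_lt.
near=> h; have h0 : 0 < h by [].
have Uh (k : 'I_m) : `]t, t + h] `<=` U k.
  by move: k; near: h; exact: filter_forall.
have gh k : (k < m)%N -> (g t k + h%:E <= g (t + h)%R k)%E.
  move=> km; have -> : h%:E = mu `]t, t + h]%classic.
    rewrite lebesgue_measure_itv/= lte_fin ltrDl h0 -EFinD.
    by rewrite addrAC subrr add0r.
  rewrite -measureU//.
    apply: le_measure; rewrite ?inE; [|exact: mUt|].
      by apply: measurableU; [exact: mUt|exact: measurable_itv].
    move=> x /= [[Ux]|]; rewrite !in_itv/=.
      by move=> xt; split => //; rewrite (le_trans xt)// lerDl ltW.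
    move=> xt; split; last by case/andP: xt.
    by apply: (Uh (Ordinal km)); rewrite /= in_itv.
  - exact: mUt.
  apply/seteqP; split => x //= [[_]]; rewrite !in_itv/= => xt.
  by rewrite ltNge xt.
have : (\sum_(0 <= k <oo) g t k + (m%:R * h)%R%:E <=
        \sum_(0 <= k <oo) g (t + h)%R k)%E.
  rewrite (nneseries_split 0 m)//= (nneseries_split 0 m (f := g (t + h)%R))//=.
  rewrite addeAC leeD//; last first.
    by apply: lee_nneseries => // k _; apply: gm; rewrite lerDl ltW.
  have -> : (m%:R * h)%R%:E = (\sum_(0 <= k < m) h%:E)%E.
    by rewrite sumEFin big_const_nat subn0 iter_addr addr0 mulr_natl.
  rewrite -big_split/= !big_mkord; apply: lee_sum => k _; exact: gh.
rewrite -(fineK (sfin t)) -(fineK (sfin (t + h))) -EFinD lee_fin /=.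
by apply: le_trans; rewrite lerD2l ler_pM2r.
Unshelve. all: by end_near. Qed.

(** Continuous induction: the bound [v t <= v c + G t + del * (t - c)] extends beyond any [tau < d]
    up to which it holds. Outside [N] the term in [del] absorbs the growth of [v]; on [N] the
    infinite slope of [G] absorbs any finite rate [M]. Left continuity of [v] gives the bound at the
    supremum itself. *)
Lemma dini_nonincreasing N v c d : c <= d -> mu.-negligible N ->
  (forall t, c <= t < d -> ~ N t -> forall e, 0 < e ->
     \forall h \near 0^'+, v (t + h) <= v t + e * h) ->
  (forall t, c <= t < d -> exists M,
     \forall h \near 0^'+, v (t + h) <= v t + M * h) ->
  (forall t, c < t <= d -> v s @[s --> t^'-] --> v t) ->
  v d <= v c.
Proof.
move=> cd N0 vN vM vc; apply/ler_addgt0Pr => e e0.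
have e20 : 0 < e / 2 by rewrite divr_gt0.
have [G [Gm Gb GN]] := negligible_infinite_slope e20 N0.
(* Chosen so that [del * (d - c) <= e / 2]; the added 1 keeps the denominator positive when
   [c = d]. *)
pose del := e / 2 / (d - c + 1).
have dc0 : 0 < d - c + 1 by rewrite ltr_wpDl// subr_ge0.
have del0 : 0 < del by rewrite divr_gt0.
pose P t := v t <= v c + G t + del * (t - c).
pose S := [set t | c <= t <= d /\ forall s, c <= s <= t -> P s].
have Sc : S c.
  split; first by rewrite lexx.
  move=> s; rewrite -eq_le => /eqP <-; rewrite /P subrr mulr0 addr0 lerDl.
  by case/andP: (Gb c).
have Sub : ubound S d by move=> t [/andP[]].
have hS : has_sup S by split; [exists c | exists d].
pose tau := sup S.
have ctau : c <= tau by exact: ub_le_sup hS.2 _ Sc.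
have taud : tau <= d by apply: ge_sup => //; exists c.
have Plt s : c <= s -> s < tau -> P s.
  move=> cs stau; have [t [_ St] st] := sup_gt hS.1 stau.
  by apply: St; rewrite cs ltW.
have Ptau : P tau.
  have [ctau'|ctau'] := ltP c tau; last first.
    have -> : tau = c by apply/eqP; rewrite eq_le ctau' ctau.
    by case: Sc => _; apply; rewrite lexx.
  (* As [G] is nondecreasing, the bounds at [s < tau] are at most the bound at [tau], which does not
     depend on [s]. *)
  apply: (cvgr_to_le (vc tau _)); first by rewrite ctau' taud.
  near=> s; have stau : s < tau by [].
  have cs : c <= s by near: s; exact: nbhs_left_ge.
  rewrite (le_trans (Plt s cs stau))// lerD// ?lerD2l; first exact/Gm/ltW.
  by rewrite ler_pM2l// lerD2r ltW.
have Stau : S tau.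
  split; first by rewrite ctau taud.
  move=> s /andP[cs]; rewrite le_eqVlt => /predU1P[->//|]; exact: Plt.
have vstep : tau < d -> \forall h \near 0^'+, P (tau + h).
  move=> taud'; have taui : c <= tau < d by rewrite ctau.
  suff : \forall h \near 0^'+,
      v (tau + h) <= v tau + (G (tau + h) - G tau) + del * h.
    apply: filterS => h; move/le_trans; apply.
    move: Ptau; rewrite /P; lra.
  have [Nt|Nt] := pselect (N tau).
    have [M HM] := vM _ taui; near=> h.
    have h0 : 0 < h by [].
    have : v (tau + h) <= v tau + M * h by near: h.
    have : G tau + M * h <= G (tau + h) by near: h; exact: GN.
    have : 0 <= del * h by rewrite mulr_ge0// ltW.
    lra.
  near=> h; have h0 : 0 <= h by rewrite ltW.
  have : v (tau + h) <= v tau + del * h by near: h; exact: vN.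
  have : G tau <= G (tau + h) by rewrite Gm// lerDl.
  lra.
have tauE : tau = d.
  apply/eqP; rewrite eq_le taud leNgt; apply/negP => taud'.
  have [r r0 rP] := near_right0_itv (vstep taud').
  (* Small enough for [rP] and for [tau + h] to be at most [d]; then [tau + h] lies in [S], beyond
     its supremum. *)
  pose h := Num.min (r / 2) (d - tau).
  have h0 : 0 < h by rewrite lt_min divr_gt0//= subr_gt0.
  have hr : h < r.
    rewrite gt_min; apply/orP; left.
    by rewrite ltr_pdivrMr// mulr_natr mulr2n ltrDl.
  have hd : tau + h <= d.
    by rewrite -lerBrDl ge_min lexx orbT.
  have : S (tau + h).
    split; first by rewrite hd andbT (le_trans ctau)// lerDl ltW.
    move=> s /andP[cs sh]; have [st|ts] := leP s tau.
      by case: Stau => _; apply; rewrite cs.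
    have -> : s = tau + (s - tau) by rewrite addrC subrK.
    apply: rP; rewrite subr_gt0 ts/=; apply: le_lt_trans hr.
    by rewrite lerBlDl.
  by move/(ub_le_sup hS.2); rewrite leNgt ltrDl h0.
move: Ptau; rewrite tauE /P => /le_trans; apply.
rewrite -addrA lerD2l; have /andP[_ Gd] := Gb d.
rewrite [leRHS]splitr lerD// /del mulrAC ler_pdivrMr//.
by rewrite ler_pM2l// lerDl.
Unshelve. all: by end_near. Qed.

End dini.

(** * Difference quotients along a filter *)

Section difference_quotients.
Context {R : realType} {V : normedModType R}.
Implicit Types (x y : R -> V) (e : R -> R) (t h : R) (d : V).

(** Puts two-sided derivatives in the quotient form that [is_solution] uses at the initial time. *)
Lemma is_derive_quotP x t d :
  is_derive t 1 x d <-> h^-1 *: (x (t + h) - x t) @[h --> 0^'] --> d.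
Proof.
have qE : (fun h => h^-1 *: ((x \o shift t) (h *: 1) - x t)) =
          (fun h => h^-1 *: (x (t + h) - x t)).
  by apply/funext => h /=; rewrite [h *: 1]mulr1 (addrC h).
split=> [[]|xd].
  by rewrite /derivable /derive qE => /cvgP + <-.
apply: DeriveDef; rewrite /derivable /derive qE; [apply: (cvgP d); exact: xd|].
by apply: cvg_lim xd.
Qed.

Lemma cvg_of_quot (F : set_system R) {FF : Filter F} x t d :
  (\forall h \near F, h != 0) -> h @[h --> F] --> (0 : R) ->
  h^-1 *: (x (t + h) - x t) @[h --> F] --> d -> x (t + h) @[h --> F] --> x t.
Proof.
move=> F0 Fc xd.
have : x t + h *: (h^-1 *: (x (t + h) - x t)) @[h --> F] --> x t + 0 *: d.
  by apply: cvgD; [exact: cvg_cst | exact: cvgZ].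
rewrite scale0r addr0; apply: cvg_trans; apply: near_eq_cvg.
apply: filterS F0 => h h0.
by rewrite scalerA mulfV// scale1r addrC subrK.
Qed.

End difference_quotients.

(** Product rule along an arbitrary filter, to serve both the two-sided derivative at later times
    and the right derivative at the initial time. *)
Lemma cvg_scale_quot {R : realType} {V : normedModType R} (F : set_system R)
    {FF : Filter F} (e : R -> R) (x : R -> V) (t de : R) (d : V) :
  (\forall h \near F, h != 0) -> h @[h --> F] --> (0 : R) ->
  h^-1 *: (e (t + h) - e t) @[h --> F] --> de ->
  h^-1 *: (x (t + h) - x t) @[h --> F] --> d ->
  h^-1 *: (e (t + h) *: x (t + h) - e t *: x t) @[h --> F]
    --> e t *: d + de *: x t.
Proof.
move=> F0 Fc ed xd.
have ec : e (t + h) @[h --> F] --> e t by exact: cvg_of_quot ed.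
have -> : (fun h => h^-1 *: (e (t + h) *: x (t + h) - e t *: x t)) =
    (fun h => e (t + h) *: (h^-1 *: (x (t + h) - x t)) +
              (h^-1 *: (e (t + h) - e t)) *: x t).
  apply/funext => h; rewrite scalerA mulrC -!scalerA -scalerDr; congr (_ *: _).
  by rewrite scalerBr scalerBl addrA subrK.
by apply: cvgD; [exact: cvgZ | exact: cvgZr_tmp].
Qed.

(** The upper limit is an infimum over right neighbourhoods of suprema, so some neighbourhood has
    its supremum below [e]. *)
Lemma upper_dini_lt {R : realType} (g : R -> R) (t e : R) :
  (upper_dini g t < e%:E)%E -> \forall h \near 0^'+, g (t + h) <= g t + e * h.
Proof.
move=> /ereal_inf_lt[_ [A nA <-]] Ae; near=> h; have h0 : 0 < h by [].
rewrite -lerBlDl -ler_pdivrMr// -lee_fin ltW//; apply: le_lt_trans Ae.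
apply: ereal_sup_ubound; exists h => //.
by near: h.
Unshelve. all: by end_near. Qed.

(** * Weak pairings and the decay of the norm along curves *)

Section weak_pairing_theory.
Context {R : realType} {n : nat} (nrm : 'cV[R]_n -> R)
  (wp : 'cV[R]_n -> 'cV[R]_n -> R)
  (Hn : is_norm nrm) (Hwp : weak_pairing wp) (Has : associated wp nrm).
Implicit Types (x y v : 'cV[R]_n) (a b s t h : R).

Lemma wpD x y v : wp (x + y) v <= wp x v + wp y v.
Proof. by case: Hwp => -[]. Qed.

Lemma wpZl a x v : 0 <= a -> wp (a *: x) v = a * wp x v.
Proof. by case: Hwp => _ [H _] _ _ /H -/(_ x v)[]. Qed.

Lemma wpZr a x v : 0 <= a -> wp x (a *: v) = a * wp x v.
Proof. by case: Hwp => _ [H _] _ _ /H -/(_ x v)[]. Qed.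

(* Deimling's inequality is needed when [a < 0]: the axioms of a weak pairing
   only bound [wp (- x) x] from below. *)
Lemma wpZ_diag a x : deimling wp nrm -> wp (a *: x) x <= a * nrm x ^+ 2.
Proof.
move=> Hd; have [a0|/ltW a0] := leP 0 a; first by rewrite wpZl// Has.
rewrite -(opprK a) scaleNr -scalerN wpZl ?oppr_ge0// [leRHS]mulNr -mulrN.
rewrite ler_wpM2l ?oppr_ge0// (le_trans (Hd _ _))// expr2 -mulrN.
by rewrite ler_wpM2l ?is_norm_ge0//; exact: lim_dirquotN.
Qed.

(** For [t0 < s], [dini_nonincreasing] applies to the norm on [[s, t]], where [y] is differentiable;
    right continuity at [t0] then covers [s = t0]. *)
Lemma curve_norm_nonincreasing (y : R -> 'cV[R]_n) t0 :
  curve_norm_derivative wp nrm ->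
  (forall t, t0 < t -> derivable y t 1) ->
  y (t0 + h) @[h --> 0^'+] --> y t0 ->
  (forall t, t0 < t -> wp ('D_1 y t) (y t) <= 0) ->
  (forall s t, t0 < s -> s <= t -> y s = 0 -> y t = 0) ->
  forall s t, t0 <= s -> s <= t -> nrm (y t) <= nrm (y s).
Proof.
move=> Hc dy y0 wy yz.
have [C C0 nC] := is_norm_le_mx_norm Hn.
have noninc s t : t0 < s -> s <= t -> nrm (y t) <= nrm (y s).
  move=> t0s st; pose N := ~` [set r | t0 < r < t + 1 ->
    ((nrm (y r))%:E * upper_dini (fun s => nrm (y s)) r
     = (wp ('D_1 y r) (y r))%:E)%E].
  have N0 : (@lebesgue_measure R).-negligible N.
    by apply: (Hc t0 (t + 1) y) => r /andP[/dy].
  apply: (@dini_nonincreasing _ N (fun r => nrm (y r)) _ _ st N0).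
  - move=> r /andP[sr rt] /contrapT Nr e e0.
    have t0r : t0 < r by exact: lt_le_trans sr.
    have /= := Nr; rewrite t0r (lt_trans rt) ?ltrDl// => /(_ isT) {}Nr.
    (* At a zero of [y] the formula is a trivial identity; the persistence of zeros is used
       instead. *)
    have [yr0|yr0] := eqVneq (y r) 0.
      near=> h; have h0 : 0 < h by [].
      by rewrite (yz r)// ?yr0 ?lerDl ?mulr_ge0// ltW.
    apply: (@upper_dini_lt _ (fun r => nrm (y r))).
    have nr := is_norm_gt0 Hn yr0.
    (* A positive Dini derivative, even an infinite one, would make its product with [nrm (y r)]
       positive, against the sign of the pairing. *)
    apply: (@le_lt_trans _ _ 0%E); last by rewrite lte_fin.
    rewrite leNgt; apply/negP => D0.
    have : (0 < (nrm (y r))%:E * upper_dini (fun s => nrm (y s)) r)%E.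
      by apply: mule_gt0 => //; rewrite lte_fin.
    by rewrite Nr lte_fin ltNge wy.
  - move=> r /andP[sr rt].
    have t0r : t0 < r by exact: lt_le_trans sr.
    have /is_derive_quotP/cvg_dnbhs_at_right yr := derivableP (dy r t0r).
    (* The difference quotient of [y] eventually has matrix norm at most that of the derivative plus
       1, and [C] converts this into a bound for [nrm]. *)
    exists (C * (`|'D_1 y r| + 1)); near=> h; have h0 : 0 < h by [].
    rewrite -lerBlDl (le_trans (is_normB_le Hn _ _))//.
    rewrite (le_trans (nC _))// -mulrA ler_pM2l//.
    rewrite -ler_pdivrMr// -[`|_| / h]mulrC.
    rewrite -[X in X * _](gtr0_norm (x := h^-1)) ?invr_gt0// -normrZ.
    near: h; apply: (cvgr_norm_le _ yr).
    by rewrite ltrDl.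
  - move=> r /andP[sr _]; apply: cvg_at_left_filter.
    apply: (@continuous_comp _ _ _ y nrm); last exact: is_norm_continuous.
    apply/differentiable_continuous/derivable1_diffP/dy.
    exact: lt_trans sr.
move=> s t t0s st; have [t0s'|] := ltP t0 s; first exact: noninc.
move=> st0; have -> : s = t0 by apply/eqP; rewrite eq_le st0 t0s.
have [t0t|tt0] := ltP t0 t; last first.
  by have -> : t = t0 by apply/eqP; rewrite eq_le tt0 (le_trans t0s).
have ny : nrm (y (t0 + h)) @[h --> 0^'+] --> nrm (y t0).
  by apply: continuous_cvg => //; exact: is_norm_continuous.
apply: (cvgr_to_ge ny); near=> h; apply: noninc; first by rewrite ltrDl.
rewrite -lerBrDl; near: h; apply: nbhs_right_le.
by rewrite subr_gt0.
Unshelve. all: by end_near. Qed.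

End weak_pairing_theory.

(** * Trajectories and the implications between the three conditions *)

Section flows.
Context {R : realType} {n : nat} (f : R -> 'cV[R]_n -> 'cV[R]_n)
  (phi : R -> R -> 'cV[R]_n -> 'cV[R]_n) (nrm : 'cV[R]_n -> R)
  (wp : 'cV[R]_n -> 'cV[R]_n -> R).
Implicit Types (x : R -> 'cV[R]_n) (b s t : R).

Lemma is_solution_restrict t0 s x :
  t0 < s -> is_solution f t0 x -> is_solution f s x.
Proof.
move=> t0s [_ dx]; split; last by move=> t /(lt_trans t0s)/dx.
exact/cvg_dnbhs_at_right/is_derive_quotP/dx.
Qed.

(** From time [s] on, both [x] and the constant 0 are solutions with state 0 at [s], so uniqueness
    identifies each with the flow. *)
Lemma is_solution_eq0 t0 s t x : is_flow_on orthant f phi -> equilibrium f 0 ->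
  0 <= t0 -> is_solution f t0 x -> t0 < s -> s <= t -> x s = 0 -> x t = 0.
Proof.
move=> Hf He t00 xs t0s st xs0.
have s0 : 0 <= s by rewrite (le_trans t00)// ltW.
have o0 : @orthant R n 0 by move=> i; rewrite mxE.
have [_ _ phiu] := Hf s 0 s0 o0.
rewrite (phiu _ (is_solution_restrict t0s xs))//.
rewrite -(phiu (cst 0))//; split=> [|r sr] /=.
  have -> : (fun h : R => h^-1 *: (0 - 0 : 'cV[R]_n)) = cst 0.
    by apply/funext => h; rewrite subrr scaler0.
  by rewrite He//; exact: cvg_cst.
by rewrite He ?(le_trans s0) ?ltW//; exact: is_derive_cst.
Qed.

Lemma is_derive_expRM (a t : R) :
  is_derive t (1 : R) (fun s => expR (a * s)) (a * expR (a * t)).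
Proof.
have -> : (fun s => expR (a * s)) = expR \o (a \*: id) by apply/funext.
by apply: is_derive_eq; rewrite /GRing.scale/= mulr1 mulrC.
Qed.

Lemma condA1_condA2 b :
  is_flow_on orthant f phi -> forward_invariant orthant phi ->
  equilibrium f 0 -> is_norm nrm -> weak_pairing wp -> associated wp nrm ->
  deimling wp nrm -> curve_norm_derivative wp nrm ->
  condA1 f nrm wp b -> condA2 phi nrm b.
Proof.
move=> Hf Hi He Hn Hwp Has Hd Hc A1 t0 s t x0 t00 t0s st ox0.
have [_ xs _] := Hf t0 x0 t00 ox0; have [xr dx] := xs.
pose x u := phi u t0 x0; pose e u := expR (- b * u); pose y u := e u *: x u.
have e0 u : 0 < e u by exact: expR_gt0.
have de u : is_derive u (1 : R) e (- b * e u) by exact: is_derive_expRM.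
have ox u : t0 <= u -> orthant (x u) by move=> t0u; exact: Hi.
have dy u : t0 < u -> is_derive u 1 y (e u *: f u (x u) + (- b * e u) *: x u).
  move=> t0u; apply/is_derive_quotP; apply: cvg_scale_quot.
  - exact: nbhs_dnbhs_neq.
  - exact: nbhs_dnbhs.
  - exact/is_derive_quotP.
  - exact/is_derive_quotP/dx.
have F0 : \forall h \near (0 : R)^'+, h != 0 by exact: nbhs_right_neq.
have Fc : h @[h --> (0 : R)^'+] --> (0 : R).
  by apply: cvg_at_right_filter; exact: cvg_id.
have yr : y (t0 + h) @[h --> 0^'+] --> y t0.
  (* At the initial time only the right derivative of [x] is available; the product rule along
     [0^'+] yields right continuity of [y]. *)
  apply: (cvg_of_quot F0 Fc (d := e t0 *: f t0 (x t0) + (- b * e t0) *: x t0)).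
  apply: cvg_scale_quot => //.
  exact/cvg_dnbhs_at_right/is_derive_quotP.
have ny u : nrm (y u) = e u * nrm (x u) by rewrite is_normZ// gtr0_norm.
have : nrm (y t) <= nrm (y s).
  apply: (curve_norm_nonincreasing Hn Hc (y := y) (t0 := t0)) => //.
  - by move=> u /dy[].
  - move=> u t0u; have [_ ->] := dy u t0u.
    (* The derivative of [y] is [e u *: (f u (x u) + (- b) *: x u)]. The positive factors [e u]
       leave both arguments of the pairing, and the bound from (A1) cancels the one from [wpZ_diag]
       with factor [- b]. *)
    rewrite [- b * _]mulrC -scalerA -scalerDr /y.
    rewrite (wpZl Hwp _ _ (ltW (e0 u))) (wpZr Hwp _ _ (ltW (e0 u))).
    rewrite pmulr_rle0// pmulr_rle0// (le_trans (wpD Hwp _ _ _))//.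
    have := wpZ_diag Hn Hwp Has (- b) (x u) Hd.
    have := A1 u (x u) (le_trans t00 (ltW t0u)) (ox u (ltW t0u)).
    lra.
  - move=> u v t0u uv /eqP; rewrite scaler_eq0 gt_eqF//= => /eqP xu0.
    rewrite /y; have -> : x v = 0 by exact: is_solution_eq0 xs t0u uv xu0.
    by rewrite scaler0.
rewrite !ny -ler_pdivlMl// mulrA; congr (_ <= _ * _).
by rewrite /e -expRN -expRD; congr expR; ring.
Qed.

(** Replacing [x + h *: v] by [phi (t + h) t x] changes the norm by at most [h * nrm w], where [w],
    the gap between [v] and the difference quotient of the trajectory, tends to 0. By (A2) the
    remaining quotient is at most [(expR (b * h) - 1) / h * nrm x], which tends to [b * nrm x]. *)
Lemma condA2_condA1 b : is_flow_on orthant f phi -> is_norm nrm ->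
  deimling wp nrm -> condA2 phi nrm b -> condA1 f nrm wp b.
Proof.
move=> Hf Hn Hd A2 t x t0 ox.
have [xt [xr _] _] := Hf t x t0 ox.
have [C C0 nC] := is_norm_le_mx_norm Hn.
pose v := f t x; rewrite xt -/v in xr.
rewrite (le_trans (Hd _ _))// expr2 mulrCA ler_wpM2l ?is_norm_ge0//.
have eb : (expR (b * h) - 1) / h @[h --> 0^'+] --> b.
  have /is_derive_quotP/cvg_dnbhs_at_right := is_derive_expRM b 0.
  rewrite mulr0 expR0 mulr1; apply: cvg_trans; apply: near_eq_cvg.
  by apply: nearW => h; rewrite add0r [RHS]mulrC.
have bound : (expR (b * h) - 1) / h * nrm x +
    C * `|v - h^-1 *: (phi (t + h) t x - x)| @[h --> 0^'+]
    --> b * nrm x + C * `|v - v|.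
  apply: cvgD; first by apply: cvgM => //; exact: cvg_cst.
  apply: cvgM; first exact: cvg_cst.
  by apply: cvg_norm; apply: cvgB => //; exact: cvg_cst.
rewrite subrr normr0 mulr0 addr0 in bound.
have dc : dirquot nrm x v h @[h --> 0^'+] -->
    lim (dirquot nrm x v h @[h --> 0^'+]) by exact: dirquot_cvg.
apply: (ler_cvg_to dc bound).
near=> h; have h0 : 0 < h by [].
rewrite /dirquot ler_pdivrMr// mulrDl mulrAC divfK ?gt_eqF//.
have A2h := A2 t t (t + h) x t0 (lexx _) _ ox.
have {}A2h : nrm (phi (t + h) t x) <= expR (b * h) * nrm x.
  by have := A2h; rewrite lerDl ltW// xt addrAC subrr add0r; exact.
pose w := v - h^-1 *: (phi (t + h) t x - x).
have wC : nrm w * h <= C * `|w| * h by rewrite ler_pM2r.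
have tri : nrm (x + h *: v) <= nrm (phi (t + h) t x) + nrm w * h.
  have -> : nrm w * h = nrm (h *: w) by rewrite is_normZ// gtr0_norm// mulrC.
  rewrite (le_trans _ (is_norm_triangle Hn _ _))// /w scalerBr scalerA.
  rewrite mulfV ?gt_eqF// scale1r opprB addrCA.
  by rewrite [phi (t + h) t x + _]addrC subrK addrC.
rewrite -/w; lra.
Unshelve. all: by end_near. Qed.

Lemma condA3_condA1 B b : is_norm nrm -> weak_pairing wp -> associated wp nrm ->
  deimling wp nrm -> condA3 f nrm B b -> condA1 f nrm wp b.
Proof.
move=> Hn Hwp Has Hd A3 t x t0 ox; have [-> Bb] := A3 t x t0 ox.
(* The conic measure ranges over nonzero vectors only; at 0 both sides vanish. *)
have [->|x0] := eqVneq x 0.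
  by rewrite mulmx0 -Has is_norm0// expr0n mulr0.
rewrite (le_trans (Hd _ _))// expr2 mulrCA ler_wpM2l ?is_norm_ge0//.
rewrite (le_trans (lim_dirquot_conic Hn _ ox x0))//.
by rewrite mulrC ler_wpM2r ?is_norm_ge0.
Qed.

End flows.

Theorem mainTheorem4 (R : realType) (n : nat)
    (f : R -> 'cV[R]_n -> 'cV[R]_n)
    (phi : R -> R -> 'cV[R]_n -> 'cV[R]_n)
    (nrm : 'cV[R]_n -> R) (wp : 'cV[R]_n -> 'cV[R]_n -> R) (b : R) :
  is_flow_on orthant f phi ->
  forward_invariant orthant phi ->
  equilibrium f 0 ->
  is_norm nrm ->
  weak_pairing wp ->
  associated wp nrm ->
  deimling wp nrm ->
  curve_norm_derivative wp nrm ->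
  (condA1 f nrm wp b <-> condA2 phi nrm b) /\
  ((exists B : R -> 'cV[R]_n -> 'M[R]_n, condA3 f nrm B b) ->
     condA1 f nrm wp b /\ condA2 phi nrm b).
Proof.
move=> Hf Hi He Hn Hwp Has Hd Hc.
have A12 := condA1_condA2 (b := b) Hf Hi He Hn Hwp Has Hd Hc.
split; first by split=> //; exact: condA2_condA1.
move=> [B A3]; have A1 : condA1 f nrm wp b by exact: condA3_condA1 A3.
by split=> //; exact: A12.
Qed.
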